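(* Let $\mathbb{C}$ be an initial configuration on $S$ stacks. Property 8 subsumes Property 4 as a special case: every block subset $\mathbb{B}^4$ of $\mathbb{C}$ that satisfies P4 also satisfies P8.
   Context: Setting (block relocation problem). There are $S$ stacks and $B$ blocks labelled by $\mathbb{B}=\{1,\dots,B\}$; a smaller label means a higher priority (earlier retrieval). The initial configuration $\mathbb{C}$ places every block in exactly one stack, each stack being a finite vertical sequence of blocks. The target block is the block of highest priority. It is assumed that no block is directly retrievable in $\mathbb{C}$ (the target block is not topmost). In a configuration, a block is badly placed (BP) if some block below it in the same stack has a smaller label; otherwise it is well placed (WP). P4: let the target block be in stack $s$. Let $\mathbb{B}^4$ be the union of the set of blocks above the target block in stack $s$ and the set consisting of the block with the highest priority in each of the other $S-1$ stacks that is nonempty. $\mathbb{B}^4$ satisfies P4 if in every experiment in which each block above the target block is relocated exactly once (from top to bottom, each to the top of one of the other $S-1$ stacks, without considering the stack height limit and without moving blocks of other stacks), some relocated block fails to become WP. P8: a block set satisfies P8 if it can be written as $F\cup G$ such that for some block $i$, in a stack $s$ say: $F$ consists of blocks above $i$ in stack $s$ with priorities lower than that of $i$; $G$ consists of at most one WP block (with respect to $\mathbb{C}$) from each of the other $S-1$ stacks, each with priority lower than that of $i$; and, after removing from $\mathbb{C}$ all blocks except those of $F\cup G$, in every experiment in which each block of $F$ is relocated exactly once (from top to bottom, each to the top of one of the other $S-1$ stacks, without considering the stack height limit and without moving blocks of $G$), some relocated block fails to become WP. *)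

(* Defs.v *)
From mathcomp Require Import all_boot.

Set Implicit Arguments.
Unset Strict Implicit.
Unset Printing Implicit Defensive.

(* Blocks are the ordinals 'I_B, the ordinal k standing for the label k.+1, so
   that a smaller ordinal has a higher priority.  Stacks are listed from top to
   bottom: the head of the list is the topmost block. *)

Definition config (S B : nat) := {ffun 'I_S -> seq 'I_B}.

Section Stacks.
Variable B : nat.
Implicit Types (b : 'I_B) (st : seq 'I_B).

Definition above b st : seq 'I_B := take (index b st) st.

Definition below b st : seq 'I_B := drop (index b st).+1 st.

End Stacks.

Section Configurations.
Variables S B : nat.
Implicit Types (C : config S B) (s u : 'I_S) (b : 'I_B) (A F G : {set 'I_B}).

Definition target C b : bool :=
  [exists s, b \in C s] && [forall s, all (fun c : 'I_B => b <= c) (C s)].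

Definition BP C b : bool :=
  [exists s, (b \in C s) && has (fun c : 'I_B => c < b) (below b (C s))].

Definition WP C b : bool := ~~ BP C b.

Record initial C : Prop := Initial {
  initial_placed : forall b, \sum_(s < S) count_mem b (C s) = 1;
  initial_not_retrievable :
    forall b s, target C b -> ohead (C s) != Some b
}.

Definition relocate s C u : config S B :=
  if C s is b :: r then
    [ffun v => if v == u then b :: C u else if v == s then r else C v]
  else C.

(* An experiment relocating the n topmost blocks of stack s, from top to
   bottom, is given by the list ds of their successive destinations.  A
   relocated block stays above the same blocks until the end of the experiment,
   so whether it has become WP can be read off the final configuration. *)
Definition experiment C s (ds : seq 'I_S) : config S B :=
  foldl (relocate s) C ds.

Definition every_experiment_fails C s (n : nat) : Prop :=
  forall ds : n.-tuple 'I_S, s \notin ds ->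
    exists2 b, b \in take n (C s) & ~~ WP (experiment C s ds) b.

Definition keep_only A C : config S B :=
  [ffun s => [seq b <- C s | b \in A]].

Definition others_highest C s : {set 'I_B} :=
  [set b | [exists u, [&& u != s, b \in C u
                        & all (fun c : 'I_B => b <= c) (C u)]]].

Definition P4 C A : Prop :=
  exists (t : 'I_B) (s : 'I_S),
    [/\ target C t, t \in C s,
        A = [set b in above t (C s)] :|: others_highest C s
      & every_experiment_fails C s (size (above t (C s)))].

(* Stack s of keep_only (F :|: G) C consists of exactly the blocks of F, so the
   #|F| topmost blocks relocated in the last clause are those of F. *)
Definition P8 C A : Prop :=
  exists F G (i : 'I_B) (s : 'I_S),
    A = F :|: G /\
    [/\ i \in C s,
        forall b, b \in F -> b \in above i (C s) /\ i < b,
        forall b, b \in G ->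
          [/\ exists2 u, u != s & b \in C u, WP C b & i < b],
        forall u, u != s -> #|[set b in G | b \in C u]| <= 1
      & every_experiment_fails (keep_only (F :|: G) C) s #|F|].

End Configurations.

(* Main.v *)
Require Import Defs.
From mathcomp Require Import all_boot.

(** Take [i] to be the target block, [F] the blocks above it and [G] the highest
    priority blocks of the other stacks.  Whether a relocated block is badly
    placed depends only on the relocated blocks below it and on the smallest
    label of its destination stack, and both are the same in [C] and in the
    configuration reduced to [F] and [G]. *)

Section Stacks.
Set Implicit Arguments.
Unset Strict Implicit.
Variable B : nat.
Implicit Types (b : 'I_B) (st : seq 'I_B).

Lemma below_cat b st1 st2 :
  b \in st1 -> below b (st1 ++ st2) = below b st1 ++ st2.
Proof.
move=> b1; rewrite /below index_cat b1 drop_cat.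
have : index b st1 < size st1 by rewrite index_mem.
(* If [b] is last in [st1], the cut falls exactly at the junction and both sides are [st2]. *)
rewrite leq_eqVlt => /orP[/eqP->|->] //.
by rewrite ltnn subnn drop0 drop_size.
Qed.

Lemma below_sub b st : {subset below b st <= st}.
Proof. by move=> c /mem_drop. Qed.

Lemma above_sub b st : {subset above b st <= st}.
Proof. by move=> c /mem_take. Qed.

Lemma above_drop b st : above b st ++ drop (size (above b st)) st = st.
Proof. by rewrite size_takel ?index_size // cat_take_drop. Qed.

(** An occurrence in this prefix would have index [index b st], which the length of the prefix does
    not exceed. *)
Lemma notin_above b st : b \notin above b st.
Proof.
apply/negP=> bA; have := bA; rewrite -index_mem.
have -> : index b (above b st) = index b st.
  by rewrite -[in RHS](above_drop b st) index_cat bA.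
by rewrite size_take_min leq_min ltnn.
Qed.

End Stacks.

Section Configurations.
Set Implicit Arguments.
Unset Strict Implicit.
Variables S B : nat.
Implicit Types (C : config S B) (s u v : 'I_S) (b c : 'I_B).

Lemma initial_uniq C s : initial C -> uniq (C s).
Proof.
move=> hC; apply: count_mem_uniq => b.
have := initial_placed hC b; rewrite (bigD1 s) //= -has_pred1 has_count.
by case: (count_mem b (C s)) => [|[|n]].
Qed.

Lemma initial_stack_inj C b s u :
  initial C -> b \in C s -> b \in C u -> s = u.
Proof.
move=> hC bs bu; apply/eqP/negPn/negP => nsu.
have := initial_placed hC b.
rewrite (bigD1 s) //= (bigD1 u) 1?eq_sym //=.
move: bs bu; rewrite -!has_pred1 !has_count.
by case: (count_mem b (C s)) => // m; case: (count_mem b (C u)) => // n;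
   rewrite addSn addnA addnS.
Qed.

(** As nothing returns to [s], the k-th destination receives the k-th block of [s]; [rev] appears
    because later arrivals lie higher. Surplus destinations have no effect on either side. *)
Lemma experimentE C s (ds : seq 'I_S) v : s \notin ds ->
  experiment C s ds v =
    if v == s then drop (size ds) (C s)
    else rev (mask [seq d == v | d <- ds] (C s)) ++ C v.
Proof.
rewrite /experiment.
elim: ds C => [|d ds IHds] C /=; first by rewrite drop0; case: eqP => [->|].
rewrite inE negb_or => /andP[nsd nsds]; rewrite {}IHds // /relocate.
case Cs: (C s) => [|b r]; first by rewrite Cs /= !mask0.
rewrite !ffunE (negPf nsd) eqxx /=; case: (v =P s) => // _.
rewrite [v == d]eq_sym; case: eqP => [->|_] //=.
by rewrite rev_cons cat_rcons.
Qed.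

Lemma others_highestP C s b :
  reflect (exists u, [/\ u != s, b \in C u & {in C u, forall c, b <= c}])
          (b \in others_highest C s).
Proof.
rewrite inE; apply: (iffP existsP) => -[u].
  by case/and3P=> us bu /allP hb; exists u.
by case=> us bu hb; exists u; rewrite us bu; apply/allP.
Qed.

Lemma others_highest_le C s u c : u != s -> c \in C u ->
  exists2 m, m \in others_highest C s & (m \in C u) && (m <= c).
Proof.
move=> us cu; case: (arg_minnP (@nat_of_ord B) cu) => m mu hm.
exists m; last by rewrite hm // andbT.
by apply/others_highestP; exists u.
Qed.

(** The same destinations are run in both configurations, and a block that fails in [C] is shown to
    fail in the reduced one. *)
Lemma every_experiment_fails_keep_only C s t :
  initial C ->
  every_experiment_fails C s (size (above t (C s))) ->
  every_experiment_fails
    (keep_only ([set b in above t (C s)] :|: others_highest C s) C) s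
    (size (above t (C s))).
Proof.
move=> hC; set a := above t (C s); set K := keep_only _ C => failC ds nds.
have nda b : b \in drop (size a) (C s) -> b \notin a.
  have := initial_uniq s hC; rewrite -[X in uniq X](above_drop t (C s)).
  by rewrite cat_uniq => /and3P[_ /hasPn + _]; apply.
(* The rest of stack [s] disappears: its blocks are not in [a] by uniqueness, and the highest blocks
   kept lie in other stacks. *)
have Ks : K s = a.
  rewrite ffunE -[X in filter _ X](above_drop t (C s)) -/a filter_cat.
  rewrite -[RHS]cats0; congr (_ ++ _).
    by apply/all_filterP/allP=> b ba; rewrite !inE ba.
  rewrite (eq_in_filter (a2 := pred0)) ?filter_pred0 // => b bd.
  rewrite in_setU in_set (negPf (nda _ bd)) /=.
  apply/negP=> /others_highestP[u [us bu _]].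
  by rewrite (initial_stack_inj hC bu (mem_drop bd)) eqxx in us.
have mask_a m : size m = size a -> mask m (C s) = mask m a.
  move=> szm; rewrite -[in LHS](above_drop t (C s)) -/a -[in LHS](cats0 m).
  by rewrite mask_cat // cats0.
have Ca : take (size a) (C s) = a.
  by rewrite -[in LHS](above_drop t (C s)) take_size_cat.
have [b] := failC ds nds; rewrite Ca => ba; rewrite negbK => /existsP[v bv].
exists b; first by rewrite Ks take_size.
rewrite negbK; apply/existsP; exists v; move: bv.
have bs := above_sub ba.
(* The failure cannot occur in [s], where only blocks outside [a] remain. *)
rewrite !experimentE // size_tuple; case: (v =P s) => [_|/eqP vs].
  by case/andP=> /nda; rewrite ba.
rewrite mask_a ?size_map ?size_tuple // Ks; set l := rev _.
have nbv : b \notin C v.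
  by apply: contra vs => bv; rewrite (initial_stack_inj hC bs bv).
rewrite !mem_cat (negPf nbv) orbF => /andP[bl]; rewrite bl /=.
(* A smaller block below [b] is either a relocated one, present in both runs, or some [c] originally
   in [v]. *)
rewrite !below_cat // !has_cat => /orP[-> //|/hasP[c cv cb]].
apply/orP; right; apply/hasP.
(* The reduction may delete [c], but it keeps the minimum [m] of [v], and [m <= c < b]. *)
have [m mo /andP[mv mc]] := others_highest_le vs cv.
exists m; last exact: leq_ltn_trans mc cb.
by rewrite ffunE mem_filter mv inE mo orbT.
Qed.

Lemma others_highest_WP C s b :
  initial C -> b \in others_highest C s -> WP C b.
Proof.
move=> hC /others_highestP[u [_ bu hb]]; apply/negP=> /existsP[v /andP[bv]].
rewrite -(initial_stack_inj hC bu bv) => /hasP[c /below_sub cu].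
by rewrite ltnNge hb.
Qed.

Lemma others_highest_stack_le1 C s u : initial C ->
  #|[set b in others_highest C s | b \in C u]| <= 1.
Proof.
move=> hC; apply/card_le1_eqP => b c.
rewrite inE => /andP[/others_highestP[v [_ bv hb]] bu].
rewrite inE => /andP[/others_highestP[w [_ cw hc]] cu].
rewrite (initial_stack_inj hC bv bu) in hb.
rewrite (initial_stack_inj hC cw cu) in hc.
by apply/val_inj/anti_leq; rewrite /= hb ?hc.
Qed.

End Configurations.

Theorem corollary3 (S B : nat) (C : config S B) (hC : initial C)
    (A : {set 'I_B}) (hA : P4 C A) : P8 C A.
Proof.
case: hA => t [s [/andP[_ /forallP tmin] ts -> failC]].
have lt_t b u : b \in C u -> b != t -> t < b.
  move=> bu bt; rewrite ltn_neqAle (allP (tmin u) b bu) andbT.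
  by rewrite eq_sym.
exists [set b in above t (C s)], (others_highest C s), t, s.
split=> //; split=> //.
- move=> b; rewrite inE => ba; split=> //.
  apply: (lt_t b s (above_sub ba)).
  by apply: contraL ba => /eqP->; exact: notin_above.
- move=> b bo; have /others_highestP[u [us bu _]] := bo.
  split; [by exists u | exact: others_highest_WP bo |].
  (* If [b] were the target, it would lie in both [u] and [s]. *)
  apply: (lt_t b u bu); apply: contra us => /eqP bt.
  by rewrite -(initial_stack_inj hC ts (_ : t \in C u)) // -bt.
- by move=> u _; exact: others_highest_stack_le1.
(* Without repetitions, the cardinal of [F] is the number of blocks above the target, so both
   experiments have the same length. *)
rewrite cardsE (card_uniqP _) ?take_uniq ?initial_uniq //.
exact: every_experiment_fails_keep_only.
Qed.
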